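(* For every rational number $x>0$, the radius of convergence $R(x)$ of the power series $[x]_q$ (the Taylor series at $q=0$ of the $q$-deformed rational $[x]_q$, with $q$ a complex variable) satisfies $$R(x) > 3-2\sqrt{2}.$$
   Context: For an integer $c\ge 1$ let $[c]_q = 1+q+\cdots+q^{c-1}$. Every rational $x>0$ has a unique finite Hirzebruch-Jung continued fraction expansion $$x=\llbracket c_1,\ldots,c_N\rrbracket := c_1-\cfrac{1}{c_2-\cfrac{1}{\ddots-\cfrac{1}{c_N}}},$$ with integers $c_1\ge 1$ and $c_j\ge 2$ for $j\ge 2$. The $q$-deformation of $x$ is the rational function $$[x]_q := [c_1]_q-\cfrac{q^{c_1-1}}{[c_2]_q-\cfrac{q^{c_2-1}}{\ddots-\cfrac{q^{c_{N-1}-1}}{[c_N]_q}}}.$$ (Equivalently, $x\mapsto [x]_q$ is the unique map on rationals with $[0]_q=0$, $[x+1]_q=q[x]_q+1$ and $[-1/x]_q=-1/(q[x]_q)$.) The function $[x]_q$ is regular at $q=0$, and $R(x)\in(0,+\infty]$ denotes the radius of convergence of its Taylor series at $q=0$ ($R(x)=+\infty$ if $[x]_q$ is a polynomial). *)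

(* Defs.v *)
From HB Require Import structures.
From mathcomp Require Import all_boot all_order all_algebra.
From mathcomp Require Import complex.
From mathcomp Require Import all_classical all_reals all_analysis.
From mathcomp Require Import ring lra zify.

Set Implicit Arguments.
Unset Strict Implicit.
Unset Printing Implicit Defensive.

Import Order.TTheory GRing.Theory Num.Theory.
Import numFieldNormedType.Exports.

Local Open Scope classical_set_scope.
Local Open Scope ring_scope.
Local Open Scope complex_scope.

(* [:: c_1; ...; c_N] with N >= 1, c_1 >= 1 and c_j >= 2 for j >= 2. *)
Definition is_hj (cs : seq nat) : bool :=
  if cs is c :: cs' then (1 <= c)%N && all (leq 2) cs' else false.

(* The value at the empty sequence is a dummy. *)
Fixpoint hj_val (cs : seq nat) : rat :=
  match cs with
  | [::] => 0
  | [:: c] => c%:R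
  | c :: cs' => c%:R - (hj_val cs')^-1
  end.

Definition hj_expansion (x : rat) : seq nat :=
  xget [::] [set cs | is_hj cs /\ hj_val cs = x].

Definition qint (K : fieldType) (q : K) (c : nat) : K := \sum_(i < c) q ^+ i.

Fixpoint qhj (K : fieldType) (q : K) (cs : seq nat) : K :=
  match cs with
  | [::] => 0
  | [:: c] => qint q c
  | c :: cs' => qint q c - q ^+ c.-1 / qhj q cs'
  end.

(* The rational function [x]_q as a function of the complex variable q. Division
   by zero is 0 in a fieldType, which only matters at finitely many q <> 0: at
   q = 0 each denominator of the continued fraction takes the value 1. *)
Definition qrat (R : realType) (x : rat) (q : R[i]) : R[i] :=
  qhj q (hj_expansion x).

(* The regular module K^o lets f be differentiated in the complex sense. *)
Definition taylor0 (K : numFieldType) (f : K -> K) (n : nat) : K :=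
  (f : K^o -> K^o)^`(n)%classic 0 / n`!%:R.

Definition pseries_cvg (K : numFieldType) (a : nat -> K) (z : K) : Prop :=
  cvgn (series (fun n => a n * z ^+ n)).

(* The supremum of the moduli of the points of convergence. *)
Definition convergence_radius (R : realType) (a : nat -> R[i]) : \bar R :=
  ereal_sup [set r%:E | r in [set r : R | exists z : R[i],
    `|z| = r%:C /\ pseries_cvg a z]].

Definition qradius (R : realType) (x : rat) : \bar R :=
  convergence_radius (taylor0 (@qrat R x)).

Lemma hj_valS c d cs : hj_val [:: c, d & cs] = c%:R - (hj_val (d :: cs))^-1.
Proof. by []. Qed.

Lemma hj_val_gt1 c cs : (2 <= c)%N -> all (leq 2) cs -> 1 < hj_val (c :: cs).
Proof.
elim: cs c => [|d cs IH] c c2 /=; first by rewrite ltr1n.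
case/andP=> d2 /(IH _ d2) h.
have c2' : 2%:R <= c%:R :> rat by rewrite ler_nat.
have : (hj_val (d :: cs))^-1 < 1 by rewrite invf_lt1 // (lt_trans _ h).
by rewrite -/(hj_val (d :: cs)) in h *; lra.
Qed.

Lemma hj_val_bounds c cs : all (leq 2) cs ->
  c%:R - 1 < hj_val (c :: cs) <= c%:R.
Proof.
case: cs => [_|d cs /andP[d2 h]]; first by rewrite /= lexx andbT; lra.
have g := hj_val_gt1 d2 h; rewrite hj_valS.
have : (hj_val (d :: cs))^-1 < 1 by rewrite invf_lt1 // (lt_trans _ g).
have : 0 < (hj_val (d :: cs))^-1 by rewrite invr_gt0 (lt_trans _ g).
by lra.
Qed.

Lemma hj_val_head c cs d ds : all (leq 2) cs -> all (leq 2) ds ->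
  hj_val (c :: cs) = hj_val (d :: ds) -> c = d.
Proof.
move=> /(hj_val_bounds c)/andP[l1 u1] /(hj_val_bounds d)/andP[l2 u2] E.
have cd : c%:R < (d.+1)%:R :> rat by rewrite mulrSr; lra.
have dc : d%:R < (c.+1)%:R :> rat by rewrite mulrSr; lra.
by move: cd dc; rewrite !ltr_nat; lia.
Qed.

Lemma hj_tail_neq0 c cs : is_hj (c :: cs) -> cs != [::] -> hj_val cs != 0.
Proof.
case: cs => [//|d cs] /andP[_ /andP[d2 h]] _.
by rewrite gt_eqF // (lt_trans _ (hj_val_gt1 d2 h)).
Qed.

Lemma hj_inj cs ds : is_hj cs -> is_hj ds -> hj_val cs = hj_val ds -> cs = ds.
Proof.
elim: cs ds => [//|c cs IH] [//|d ds] hc hd E.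
have /andP[_ ac] := hc; have /andP[_ ad] := hd.
have cd := hj_val_head ac ad E; subst d; congr cons.
case: cs ds IH hc hd ac ad E => [|c' cs] [|d' ds] // IH hc hd ac ad.
- move/eqP; rewrite hj_valS [X in X == _]/= eq_sym -subr_eq0 addrAC subrr.
  by rewrite sub0r oppr_eq0 invr_eq0 (negPf (hj_tail_neq0 hd _)).
- move/eqP; rewrite hj_valS [X in _ == X]/= -subr_eq0 addrAC subrr.
  by rewrite sub0r oppr_eq0 invr_eq0 (negPf (hj_tail_neq0 hc _)).
- rewrite !hj_valS => /addrI/oppr_inj/invr_inj E.
  case/andP: ac => c2 ac; case/andP: ad => d2 ad.
  by apply: IH => //; rewrite /is_hj ltnW.
Qed.

(* x = p / d; the successive denominators decrease. *)
Lemma hj_exists (p d : nat) : (0 < p)%N -> (0 < d)%N ->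
  exists2 cs, is_hj cs & hj_val cs = p%:R / d%:R.
Proof.
elim/ltn_ind: d p => d IH p p0 d0.
have dr : d%:R != 0 :> rat by rewrite pnatr_eq0 -lt0n.
have [c [k [c0 kd E]]] : exists c k : nat, [/\ (0 < c)%N, (k < d)%N & p + k = c * d]%N.
  exists (p.-1 %/ d).+1, (d - (p.-1 %% d).+1)%N.
  have := divn_eq p.-1 d; have := ltn_pmod p.-1 d0.
  by split; [|lia|rewrite mulSn; lia].
have Ex : p%:R / d%:R = c%:R - k%:R / d%:R :> rat.
  apply: (mulIf dr); rewrite mulrBl !divfK // -natrM -E natrD; ring.
have [k0|k0] := posnP k.
  by exists [:: c]; rewrite /= ?c0 // Ex k0 mul0r subr0.
have [[//|c' cs] /andP[c'0 hcs] V] := IH k kd d d0 k0.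
have c'2 : (2 <= c')%N.
  have /andP[_ u] := hj_val_bounds c' hcs.
  have : 1 < c'%:R :> rat.
    by apply: lt_le_trans u; rewrite V ltr_pdivlMr ?ltr0n // mul1r ltr_nat.
  by rewrite ltr1n.
exists [:: c, c' & cs]; first by rewrite /is_hj /= c0 c'2.
by rewrite hj_valS V Ex invf_div.
Qed.

Lemma hj_expansionP (x : rat) : 0 < x ->
  is_hj (hj_expansion x) /\ hj_val (hj_expansion x) = x.
Proof.
move=> x0; apply: (@xgetPex _ [::] [set cs | is_hj cs /\ hj_val cs = x]).
have n0 : 0 < numq x by rewrite numq_gt0.
have n1 : (0 < `|numq x|)%N by rewrite absz_gt0 gt_eqF.
have d1 : (0 < `|denq x|)%N by rewrite absz_gt0 denq_neq0.
have [cs h V] := hj_exists n1 d1; exists cs; split=> //.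
by rewrite V !pmulrn !gez0_abs ?denq_ge0 ?ltW // divq_num_den.
Qed.

Lemma hj_expansion_val cs : is_hj cs -> hj_expansion (hj_val cs) = cs.
Proof.
move=> h; apply: xget_unique => // ds [hd /hj_inj]; exact.
Qed.

(* Main.v *)
(* Put m = sqrt 2 - 1, so that m ^ 2 = 3 - 2 sqrt 2 and m ^ 2 + 2 m = 1. For
   |q| <= m ^ 2 and |w| >= m one has
     |[c]_q - q ^ (c - 1) / w| >= 1 - |q| - ... - |q| ^ (c - 1) - |q| ^ (c - 1) / m >= m
   for all c >= 2, the worst case being c = 2. Hence no tail of the q-deformed
   continued fraction vanishes on the closed disc of radius m ^ 2, and neither
   does the denominator Q of [x]_q = P / Q; its finitely many roots then lie
   outside a strictly larger disc. The Taylor coefficients of P / Q are found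
   by dividing P by the linear factors of Q one at a time, which preserves
   convergence at every point closer to 0 than all the roots. *)
Require Import Defs.
From mathcomp Require Import all_boot all_order all_algebra.
From mathcomp Require Import all_classical all_reals all_analysis.
From mathcomp Require Import complex ring lra.

Import Order.TTheory GRing.Theory Num.Theory.
Import numFieldNormedType.Exports.
Local Open Scope ring_scope.

(** * Taylor coefficients of a quotient of polynomials *)

Section TaylorOfFraction.
Set Implicit Arguments.
Unset Strict Implicit.
Variable K : numFieldType.
Implicit Types (A B P Q : {poly K}).

(* The library states this only over a [realFieldType]. *)
Lemma is_derive_horner P (x : K^o) :
  is_derive x (1 : K^o) (horner P : K^o -> K^o) P^`().[x].
Proof.
elim/poly_ind: P => [|P c IH].
  rewrite deriv0 horner0 (_ : horner 0 = cst 0); last first.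
    by apply/funext => y; rewrite horner0.
  exact: is_derive_cst.
rewrite (_ : horner _ = ((horner P : K^o -> K^o) * id + cst c)%R); last first.
  by apply/funext => y; rewrite !fctE !hornerE.
apply: is_derive_eq.
by rewrite derivD derivC addr0 derivM derivX mulr1 !hornerE addrC mulrC [_%:A]mulr1.
Qed.

Lemma derive1_fraction P Q (x : K^o) : Q.[x] != 0 ->
  ((fun y => P.[y] / Q.[y]) : K^o -> K^o)^`()%classic x
  = (P^`() * Q - P * Q^`()).[x] / (Q ^+ 2).[x].
Proof.
move=> Qx.
have dP := is_derive_horner P x; have dQ := is_derive_horner Q x.
have dV : derivable ((fun y => Q.[y]^-1) : K^o -> K^o) x 1 by apply: derivableV.
rewrite derive1E (_ : (fun _ => _) =
  ((horner P : K^o -> K^o) * (fun y => Q.[y]^-1) : K^o -> K^o)%R) //.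
rewrite deriveM // deriveV // !derive_val.
rewrite !hornerE; rewrite /GRing.scale /=; field; exact: Qx.
Qed.

Lemma near_horner_neq0 Q (x : K^o) : Q.[x] != 0 -> \forall y \near x, Q.[y] != 0.
Proof.
move=> Qx.
have /derivable1_diffP/differentiable_continuous Qc :
  derivable (horner Q : K^o -> K^o) x 1 by have [] := is_derive_horner Q x.
exact: cvgr_neq0 Qc Qx.
Qed.

(** Differentiation turns [P / Q] into [(P' Q - P Q') / Q ^ 2] and the congruence [P = A Q] modulo
    ['X^(n.+2)] into one with [A'] and [Q ^ 2] modulo ['X^(n.+1)], so induction on [n] applies. *)
Lemma derive1n_fraction n (f : K^o -> K^o) A B P Q : Q.[0] != 0 ->
  P = A * Q + 'X^(n.+1) * B -> (\forall y \near (0 : K^o), f y = P.[y] / Q.[y]) ->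
  f^`(n)%classic 0 = A^`(n).[0].
Proof.
elim: n f A B P Q => [|n IH] f A B P Q Q0 E fE.
  rewrite derive1n0 (nbhs_singleton fE) E derivn0 !hornerE.
  by rewrite -mulrA divff // mulr1.
rewrite derive1Sn derivSn.
(* The cofactor of ['X^(n.+1)] in the numerator of the derivative of ['X^(n.+2) * B / Q]. *)
apply: (IH _ _ (n.+2%:R *: B * Q + 'X * (B^`() * Q - B * Q^`()))
   (P^`() * Q - P * Q^`()) (Q ^+ 2)).
- by rewrite hornerE expf_neq0.
- rewrite E derivD (derivM A) (derivM 'X^(n.+2)) derivXn /= scaler_nat ['X^(n.+2)]exprS.
  by rewrite -[B *+ _]mulr_natr -['X^(n.+1) *+ _]mulr_natr; ring.
have Qn := near_horner_neq0 Q0.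
(* Differentiating [f] at [y] requires the equality on a whole neighbourhood of [y]. *)
have /near_join : \forall y \near (0 : K^o), Q.[y] != 0 /\ f y = P.[y] / Q.[y].
  by near=> y; split; near: y.
apply: filterS => y fQ; rewrite -derive1_fraction; last first.
  by have [] := nbhs_singleton fQ.
by rewrite !derive1E; apply: near_eq_derive; apply: filterS fQ => z [].
Unshelve. all: by end_near. Qed.

Lemma taylor0_fraction n (f : K -> K) (a : nat -> K) B P Q : Q.[0] != 0 ->
  P = \poly_(i < n.+1) a i * Q + 'X^(n.+1) * B ->
  (\forall y \near (0 : K^o), f y = P.[y] / Q.[y]) ->
  taylor0 f n = a n.
Proof.
move=> Q0 E fE; rewrite /taylor0 (derive1n_fraction Q0 E fE).
rewrite horner_coef0 coef_derivn addn0 coef_poly leqnn ffactnn.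
by rewrite -[a n *+ _]mulr_natr mulfK // pnatr_eq0 -lt0n fact_gt0.
Qed.

End TaylorOfFraction.

(** * Division of power series by linear factors *)

Section FractionExpansion.
Set Implicit Arguments.
Unset Strict Implicit.
Variable K : numFieldType.
Implicit Types (a b : nat -> K) (s t z : K).

Definition geometric_bound s a := exists C, forall n, `|a n| * s ^+ n <= C.

Lemma geometric_bound_poly s (P : {poly K}) : 0 <= s ->
  geometric_bound s (fun n => P`_n).
Proof.
move=> s0; exists (\sum_(i < size P) `|P`_i| * s ^+ i) => n.
have [nP|Pn] := ltnP n (size P).
  rewrite (bigD1 (Ordinal nP)) //= lerDl.
  by apply: sumr_ge0 => i _; rewrite mulr_ge0 // exprn_ge0.
rewrite nth_default // normr0 mul0r.
by apply: sumr_ge0 => i _; rewrite mulr_ge0 // exprn_ge0.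
Qed.

(** A bounded sequence times a null one. That [(t / s) ^+ n] tends to 0 is assumed, because [K] may
    be non-archimedean. *)
Lemma cvg_geometric_bound s t a : 0 < s ->
  ((fun n => (t / s) ^+ n : K^o) @ \oo --> (0 : K^o))%classic ->
  geometric_bound s a -> ((fun n => a n * t ^+ n : K^o) @ \oo --> (0 : K^o))%classic.
Proof.
move=> s0 ts [C aC].
have C0 : 0 <= C by apply: le_trans (aC 0); rewrite mulr_ge0 // exprn_ge0 ?ltW.
have C1 : 0 < C + 1 by rewrite ltr_wpDl.
apply/cvgr0Pnorm_lt => e e0.
have /cvgr0Pnorm_lt/(_ _ (divr_gt0 e0 C1)) := ts.
apply: filterS => n; rewrite ltr_pdivlMr // => te.
rewrite (_ : a n * t ^+ n = a n * s ^+ n * (t / s) ^+ n); last first.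
  by rewrite -mulrA -exprMn [s * _]mulrC divfK // gt_eqF.
rewrite normrM mulrC; apply: le_lt_trans te.
apply: ler_wpM2l => //; rewrite normrM (ger0_norm (exprn_ge0 _ (ltW s0))).
by apply: (le_trans (aC n)); rewrite lerDl.
Qed.

(* The Taylor coefficients of [b / ('X - z)]. *)
Fixpoint divXsubC z b n :=
  ((if n is m.+1 then divXsubC z b m else 0) - b n) / z.

(** With [d] the quotient sequence, [b k = d (k - 1) - z * d k]; the truncated product thus
    overshoots only in degree [n.+1], by [d n]. *)
Lemma divXsubCE z b n : z != 0 ->
  \poly_(i < n.+1) b i = \poly_(i < n.+1) divXsubC z b i * ('X - z%:P)
    - 'X^(n.+1) * (divXsubC z b n)%:P.
Proof.
move=> z0.
have E k : b k = (if k is m.+1 then divXsubC z b m else 0) - z * divXsubC z b k.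
  by case: k => [|k] /=; rewrite [z * _]mulrC divfK // opprB addrC subrK.
apply/polyP => i; rewrite mulrBr !coefB coefMX coefMC coefXnM coefC !coef_poly.
case: i => [|i]; first by rewrite /= {1}E mulrC subr0.
rewrite [i.+1.-1]/= !ltnS.
have [ni|ni|->] := ltngtP n i.
- by rewrite subSS subn_eq0 leqNgt ni mul0r !subr0.
- by rewrite {1}E mulrC subr0.
- by rewrite subnn eqxx mul0r subr0 subrr.
Qed.

Lemma geometric_bound_divXsubC s z b : 0 < s -> s < `|z| ->
  geometric_bound s b -> geometric_bound s (divXsubC z b).
Proof.
move=> s0 sz [C bC].
have d0 : 0 < `|z| - s by rewrite subr_gt0.
have z0 : 0 < `|z| by apply: lt_trans sz.
have C0 : 0 <= C by apply: le_trans (bC 0); rewrite mulr_ge0 // exprn_ge0 ?ltW.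
have D0 : 0 <= C / (`|z| - s) by rewrite divr_ge0 // ltW.
(* The fixed point of [D = (D * s + C) / |z|], which the recursion for the quotient preserves as a
   bound. *)
exists (C / (`|z| - s)) => n.
have step u v k : `|u| * s ^+ k <= C / (`|z| - s) * s -> `|v| * s ^+ k <= C ->
    `|(u - v) / z| * s ^+ k <= C / (`|z| - s).
  move=> hu hv; rewrite normrM normfV mulrAC ler_pdivrMr //.
  have -> : C / (`|z| - s) * `|z| = C / (`|z| - s) * s + C.
    by field; exact: lt0r_neq0.
  apply: le_trans (lerD hu hv); rewrite -mulrDl.
  by apply: ler_wpM2r; [rewrite exprn_ge0 // ltW | exact: ler_normB].
elim: n => [|n IH] /=; apply: step (bC _).
  by rewrite normr0 mul0r mulr_ge0 // ltW.
by rewrite exprSr mulrA; apply: ler_wpM2r IH; exact: ltW.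
Qed.

Lemma series_horner a t n :
  series (fun k => a k * t ^+ k) n = (\poly_(i < n) a i).[t].
Proof. by rewrite horner_poly /series /= big_mkord. Qed.

(** Evaluating [divXsubCE] at [t] expresses the partial sums of the quotient through those of [b],
    up to a multiple of a term that tends to 0. *)
Lemma pseries_cvg_divXsubC s t z b : 0 < s -> s < `|z| -> t != z ->
  ((fun n => (t / s) ^+ n : K^o) @ \oo --> (0 : K^o))%classic ->
  geometric_bound s b -> pseries_cvg b t -> pseries_cvg (divXsubC z b) t.
Proof.
move=> s0 sz tz ts bs /cvg_ex[/= L bL].
have z0 : z != 0 by rewrite -normr_gt0; apply: lt_trans sz.
apply/cvg_ex; exists ((L + t * 0) / (t - z)) => /=.
rewrite -cvg_shiftS /=.
rewrite (_ : (fun _ => _) = (fun n => (series (fun k => b k * t ^+ k) n.+1 +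
   t * (divXsubC z b n * t ^+ n)) / (t - z) : K^o)); last first.
  apply/funext => n /=; rewrite !series_horner (divXsubCE b n z0).
  rewrite hornerD hornerN !hornerM hornerXsubC hornerXn hornerC exprS.
  by field; rewrite subr_eq0.
apply: cvgMr_tmp; apply: cvgD; first by rewrite cvg_shiftS.
by apply: cvgMl_tmp; exact: cvg_geometric_bound (geometric_bound_divXsubC s0 sz bs).
Qed.

Lemma pseries_cvg_poly (P : {poly K}) t : pseries_cvg (fun n => P`_n) t.
Proof.
apply/cvg_ex; exists P.[t] => /=; apply: cvg_near_cst.
exists (size P) => // n /= Pn; rewrite series_horner.
congr (_.[t]); apply/polyP => i; rewrite coef_poly.
by case: ltnP => // ni; rewrite nth_default // (leq_trans Pn).
Qed.

(** Each root costs one division, which keeps both the bound at [s] and convergence at [t]. One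
    sequence [a] serves every [n]; only the remainder [B] varies. *)
Lemma expansion_prod_XsubC s t (rs : seq K) b : 0 < s -> `|t| < s ->
  ((fun n => (t / s) ^+ n : K^o) @ \oo --> (0 : K^o))%classic ->
  (forall z, z \in rs -> s < `|z|) ->
  geometric_bound s b -> pseries_cvg b t ->
  exists2 a, pseries_cvg a t & forall n, exists B,
    \poly_(i < n.+1) b i =
    \poly_(i < n.+1) a i * \prod_(z <- rs) ('X - z%:P) + 'X^(n.+1) * B.
Proof.
move=> s0 ts0 ts; elim: rs b => [|z rs IH] b rsP bs bt.
  by exists b => // n; exists 0; rewrite big_nil mulr1 mulr0 addr0.
have sz : s < `|z| by apply: rsP; rewrite mem_head.
have z0 : z != 0 by rewrite -normr_gt0; apply: lt_trans sz.
have tz : t != z by apply: contraTneq sz => <-; rewrite lt_gtF.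
have [||| a at_ aB] := IH (divXsubC z b).
- by move=> w wrs; apply: rsP; rewrite inE wrs orbT.
- exact: geometric_bound_divXsubC s0 sz bs.
- exact: pseries_cvg_divXsubC s0 sz tz ts bs bt.
exists a => // n; have [B E] := aB n.
exists (B * ('X - z%:P) - (divXsubC z b n)%:P).
rewrite (divXsubCE b n z0) E big_cons; ring.
Qed.

End FractionExpansion.

(* The empty sequence stands for the point at infinity. *)
Fixpoint qhj_fraction (K : fieldType) (cs : seq nat) : {poly K} * {poly K} :=
  if cs is c :: cs' then
    let ND := qhj_fraction K cs' in
    ((\sum_(i < c) 'X^i) * ND.1 - 'X^(c.-1) * ND.2, ND.1)
  else (1, 0).

(** * Nonvanishing of the denominators on the closed disc *)

Section DenominatorBound.
Set Implicit Arguments.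
Unset Strict Implicit.
Variable R : rcfType.
Import ComplexField.Normc.
Implicit Types (q : R[i]) (m : R).

Lemma normc_ge0 (z : R[i]) : 0 <= normc z.
Proof. by case: z => a b; exact: sqrtr_ge0. Qed.

Lemma normcX (z : R[i]) n : normc (z ^+ n) = normc z ^+ n.
Proof. by elim: n => [|n IH]; rewrite ?expr0 ?normc1 // !exprS normcM IH. Qed.

Lemma lerB_normcD (z w : R[i]) : normc z - normc w <= normc (z + w).
Proof. by rewrite lerBlDr -(normcN w) -{1}(addrK w z) le_normcD. Qed.

Lemma qint_lower_bound q m c : 0 < m -> m ^+ 2 + 2 * m <= 1 ->
  normc q <= m ^+ 2 -> m ^+ 2 + normc q ^+ c.+1 <= m * normc (qint q c.+2).
Proof.
move=> m0 mE qm; have q0 := normc_ge0 q.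
elim: c => [|c IH].
  rewrite /qint !big_ord_recr big_ord0 /= add0r expr0 !expr1.
  by have := lerB_normcD 1 q; rewrite normc1; nra.
have := lerB_normcD (qint q c.+2) (q ^+ c.+2).
rewrite [qint q c.+3]big_ord_recr /= -/(qint q c.+2) normcX => h.
have p0 : 0 <= normc q ^+ c.+1 by rewrite exprn_ge0.
move: h IH; rewrite [normc q ^+ c.+2]exprS.
move: (normc q ^+ c.+1) p0 (normc (qint _ _)) (normc (_ + _)) => p p0 u v h IH.
have : m * (u - normc q * p) <= m * v by rewrite ler_pM2l.
(* Raising [c] by one lowers the left side by [p * (1 - normc q)] and the right side by at most
   [m * normc q * p]. *)
have : 0 <= p * (1 - m * normc q - normc q).
  by apply: mulr_ge0 => //; nra.
nra.
Qed.

(** This is [|w| >= m] for the tail value [w], cleared of division so that the induction can start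
    at infinity, the pair [(1, 0)]. *)
Lemma qhj_numerator_bound q m cs : 0 < m -> m ^+ 2 + 2 * m <= 1 ->
  normc q <= m ^+ 2 -> all (leq 2) cs ->
  m * normc (qhj_fraction _ cs).2.[q] <= normc (qhj_fraction _ cs).1.[q]
  /\ (qhj_fraction _ cs).1.[q] != 0.
Proof.
move=> m0 mE qm; elim: cs => [_|[//|[//|c]] cs IH /andP[_ /IH[le_DN N0]]].
  by rewrite /= -[1]/(1%:P) hornerC horner0 normc0 normc1 mulr0 ler01 oner_neq0.
move: le_DN N0 => /=; set N := (qhj_fraction _ cs).1; set D := (qhj_fraction _ cs).2.
move=> le_DN N0; rewrite !(hornerE, horner_sum).
under eq_bigr do rewrite hornerXn; rewrite -/(qint q c.+2).
have nN : 0 < normc N.[q].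
  by rewrite lt_neqAle normc_ge0 andbT eq_sym; apply: contra N0 => /eqP/eq0_normc ->.
have leN : m * normc N.[q] <= normc (qint q c.+2 * N.[q] - q ^+ c.+1 * D.[q]).
  apply: le_trans (lerB_normcD _ _); rewrite normcN !normcM normcX.
  have := qint_lower_bound c m0 mE qm.
  have : 0 <= normc q ^+ c.+1 by rewrite exprn_ge0 ?normc_ge0.
  move: (normc q ^+ c.+1) (normc (qint _ _)) => p u p0 h.
  rewrite -(ler_pM2l m0).
  have : (m ^+ 2 + p) * normc N.[q] <= m * u * normc N.[q] by rewrite ler_pM2r.
  have : p * (m * normc D.[q]) <= p * normc N.[q] by rewrite ler_wpM2l.
  nra.
split => //; apply: contraTneq leN => ->; rewrite normc0 -ltNge mulr_gt0 //.
Qed.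

(** The denominator is the numerator of the tail, so the first entry does not affect it and may be
    1. *)
Lemma qhj_fractionE q m cs : 0 < m -> m ^+ 2 + 2 * m <= 1 ->
  normc q <= m ^+ 2 -> all (leq 2) (behead cs) -> cs != [::] ->
  (qhj_fraction _ cs).2.[q] != 0 /\
  qhj q cs = (qhj_fraction _ cs).1.[q] / (qhj_fraction _ cs).2.[q].
Proof.
move=> m0 mE qm; elim: cs => [//|c cs IH] /= cs2 _.
have [_ N0] := qhj_numerator_bound m0 mE qm cs2; split => //.
rewrite !(hornerE, horner_sum); under eq_bigr do rewrite hornerXn.
rewrite -/(qint q c) mulrBl mulfK // -mulrA.
case: cs IH cs2 N0 => [|d cs] IH cs2 N0.
  by rewrite /= horner0 mul0r mulr0 subr0.
have [||_ ->] := IH => //; first by case/andP: cs2.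
by rewrite invf_div.
Qed.

End DenominatorBound.

(** * From nonvanishing on a closed disc to the radius of convergence *)

Section ComplexDisc.
Set Implicit Arguments.
Unset Strict Implicit.
Variable R : realType.
Import ComplexField.Normc.
Local Open Scope complex_scope.

Lemma cvg_expr_complex (u : R) : 0 <= u -> u < 1 ->
  ((fun n => u%:C ^+ n : R[i]^o) @ \oo --> (0 : R[i]^o))%classic.
Proof.
move=> u0 u1; apply/cvgr0Pnorm_lt => -[e i]; rewrite ltcE /= => /andP[/eqP-> e0].
have : ((fun n => u ^+ n : R) @ \oo --> (0 : R))%classic.
  by apply: cvg_expr; rewrite ger0_norm.
move=> /cvgr0Pnorm_lt/(_ _ e0); apply: filterS => n.
by rewrite -rmorphXn normc_def /= expr0n addr0 sqrtr_sqr ltcR.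
Qed.

Lemma exists_between_norms (r0 : R) (rs : seq R[i]) :
  (forall z, z \in rs -> r0 < normc z) ->
  exists2 s, r0 < s & forall z, z \in rs -> s < normc z.
Proof.
elim: rs => [|z rs IH] rsP; first by exists (r0 + 1); rewrite ?ltrDl.
have [w wrs|s r0s sP] := IH; first by apply: rsP; rewrite inE wrs orbT.
have r0z : r0 < normc z by apply: rsP; rewrite mem_head.
exists (Num.min s ((r0 + normc z) / 2)).
  by rewrite lt_min r0s midf_lt.
move=> w; rewrite inE => /orP[/eqP->|/sP sw].
  by rewrite gt_min midf_lt ?orbT.
by rewrite gt_min sw.
Qed.

Lemma convergence_radius_fraction (r0 : R) (f : R[i] -> R[i]) (P Q : {poly R[i]}) :
  0 < r0 ->
  (forall q, normc q <= r0 -> Q.[q] != 0 /\ f q = P.[q] / Q.[q]) ->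
  (r0%:E < convergence_radius (taylor0 f))%E.
Proof.
move=> r00 fP.
have Q0 : Q.[0] != 0 by have [] := fP 0; rewrite ?normc0 ?ltW.
have fE : \forall y \near (0 : R[i]^o), f y = P.[y] / Q.[y].
  have : 0 < r0%:C :> R[i] by rewrite ltcR.
  move=> /(@nbhs0_lt _ R[i]^o); apply: filterS => y; rewrite ltcR => /ltW yr.
  by have [] := fP y yr.
have lQ : lead_coef Q != 0.
  by apply: contraNneq Q0 => /eqP; rewrite lead_coef_eq0 => /eqP->; rewrite horner0.
have [rs] := closed_field_poly_normal Q.
move: (lead_coef Q) lQ => l l0 Qrs.
have [z zrs|s r0s sP] := @exists_between_norms r0 rs.
  rewrite ltNge; apply/negP => /fP[/negP Qz _]; apply: Qz.
  rewrite Qrs hornerZ (_ : _.[z] = 0) ?mulr0 //.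
  by apply/eqP; rewrite -[_ == 0]/(root _ z) root_prod_XsubC.
(* Convergence is shown at the real point [t]: [r0 < t] makes the final bound strict, and [t < s]
   makes the remainders vanish. *)
pose t := (r0 + s) / 2; have /andP[r0t ts] : r0 < t < s by rewrite !midf_lt.
have t0 : 0 < t by exact: lt_trans r0t.
have s0 : 0 < s by exact: lt_trans ts.
have tC : `|t%:C| = t%:C by rewrite ger0_norm // ler0c ltW.
pose P' := l^-1 *: P.
have [||||||a at_ aP] := @expansion_prod_XsubC R[i] s%:C t%:C rs (fun n => P'`_n).
- by rewrite ltcR.
- by rewrite tC ltcR.
- rewrite -fmorph_div; apply: cvg_expr_complex; first by rewrite divr_ge0 ?ltW.
  by rewrite ltr_pdivrMr ?mul1r.
- by move=> z /sP; rewrite -ltcR.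
- by apply: geometric_bound_poly; rewrite ler0c ltW.
- exact: pseries_cvg_poly.
have -> : taylor0 f = a.
  apply/funext => n; have [B E] := aP n.
  (* The expansion covers only the terms of [P'] of degree at most [n]; the others join the
     remainder, and [l] restores the leading coefficient of [Q]. *)
  apply: (@taylor0_fraction _ _ _ _ (l *: (B + drop_poly n.+1 P')) P Q) => //.
  have -> : P = l *: P' by rewrite scalerA divff ?scale1r.
  rewrite -[in LHS](poly_take_drop n.+1 P') /take_poly E [in RHS]Qrs.
  rewrite -!mul_polyC; ring.
apply: (@lt_le_trans _ _ t%:E); first by rewrite lte_fin.
by apply: ereal_sup_ubound; exists t => //=; exists t%:C.
Qed.

End ComplexDisc.

Theorem theorem1p2 (R : realType) (x : rat) (hx : 0 < x) :
  ((3 - 2 * Num.sqrt 2)%:E < qradius R x)%E.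
Proof.
have [cs_hj _] := hj_expansionP hx.
have sqrt2E : Num.sqrt 2 ^+ 2 = 2 :> R by rewrite sqr_sqrtr.
have sqrt2_gt1 : 1 < Num.sqrt 2 :> R by rewrite -[ltLHS]sqrtr1 ltr_sqrt ?ltr1n.
pose m : R := Num.sqrt 2 - 1.
have m0 : 0 < m by rewrite subr_gt0.
have -> : 3 - 2 * Num.sqrt 2 = m ^+ 2 by rewrite /m; ring: sqrt2E.
apply: (@convergence_radius_fraction _ _ _
  (qhj_fraction _ (hj_expansion x)).1 (qhj_fraction _ (hj_expansion x)).2).
  by rewrite exprn_gt0.
move=> q qm; apply: qhj_fractionE m0 _ qm _ _.
- by rewrite (_ : m ^+ 2 + 2 * m = 1) // /m; ring: sqrt2E.
- by case: hj_expansion cs_hj => // c cs /andP[].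
- by case: hj_expansion cs_hj.
Qed.
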